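(* For every $n\ge2$ and every graph $G^*$ on $n$ vertices with at most one loop per vertex, \[\lambda_2(G^* )-\lambda_n(G^* )\le\frac{n}{\sqrt2},\] with equality if and only if $G^*$ is isomorphic to the $t$-blowup $P_4^*(t)$ of the closed path $P_4^*$ for some positive integer $t$ (so $n=4t$). In particular, $s_{1,0}=\frac1{\sqrt2}$.
   Context: A graph with at most one loop per vertex on vertex set $\{1,\dots,n\}$ is identified with its adjacency matrix $A=(a_{uv})$, a symmetric $n\times n$ $(0,1)$-matrix where $a_{uv}=1$ iff $uv$ is an edge and $a_{uu}=1$ iff there is a loop at $u$. Its eigenvalues are listed as $\lambda_1\ge\cdots\ge\lambda_n$. The closed path $P_4^*$ is the path $v_1v_2v_3v_4$ with a loop at each of the two endpoints $v_1,v_4$ and no loops at $v_2,v_3$; its adjacency matrix is $\begin{pmatrix}1&1&0&0\\1&0&1&0\\0&1&0&1\\0&0&1&1\end{pmatrix}$. The $t$-blowup $G^*(t)$ of a graph $G^*$ with adjacency matrix $A$ is the graph with adjacency matrix $A\otimes J_t$, where $J_t$ is the $t\times t$ all-ones matrix. For a simple graph $G$ on $n$ vertices, ${\rm spread}_{i,j}(G)=\lambda_{i+1}(G)-\lambda_{n-j}(G)$; ${\rm spread}_{i,j}(n)$ is its maximum over simple graphs on $n$ vertices and $s_{i,j}=\lim_{n\to\infty}{\rm spread}_{i,j}(n)/n$ (known to exist). *)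

(* Defs.v *)
From HB Require Import structures.
From mathcomp Require Import all_boot all_order all_algebra all_fingroup.
From mathcomp Require Import polyrcf.
From mathcomp Require Import all_classical all_reals all_analysis.
Set Implicit Arguments. Unset Strict Implicit. Unset Printing Implicit Defensive.
Import Order.TTheory GRing.Theory Num.Theory.
Local Open Scope ring_scope.

Definition adjmx (R : nzRingType) (n : nat) (e : rel 'I_n) : 'M[R]_n :=
  \matrix_(i < n, j < n) (e i j)%:R.

(* The eigenvalues of a square matrix over a real closed field, listed with
   multiplicity (as roots of the characteristic polynomial) in non-increasing
   order: eigs A = [:: lambda_1; lambda_2; ...; lambda_n] when the
   characteristic polynomial splits over R (always true for real symmetric
   matrices).  lambda_k is (eigs A)`_(k-1). *)
Definition eigs (R : rcfType) (n : nat) (A : 'M[R]_n) : seq R :=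
  let p := char_poly A in
  rev (flatten [seq nseq (mup x p) x | x <- rootsR p]).

Definition lam (R : rcfType) (n : nat) (e : rel 'I_n) (k : nat) : R :=
  (eigs (adjmx R e))`_(k.-1).

(* Adjacency relation of the closed path P_4^* on vertices 0,1,2,3
   (v_1..v_4 of the paper): path 0-1-2-3 with loops at 0 and 3. *)
Definition p4star (a b : nat) : bool :=
  [|| (a == 0%N) && (b == 0%N), (a == 3%N) && (b == 3%N),
      a.+1 == b | b.+1 == a].

(* The t-blowup P_4^*(t), with adjacency matrix A (x) J_t, on vertex set
   'I_(4t): vertex a*t + b (a < 4, b < t) lies in block a. *)
Definition p4star_blowup (t : nat) (i j : nat) : bool :=
  p4star (i %/ t) (j %/ t).

Definition simple_graph (n : nat) (e : rel 'I_n) : bool :=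
  [forall i, ~~ e i i] && [forall i, forall j, e i j == e j i].

Definition spread10 (R : rcfType) (n : nat) (e : rel 'I_n) : R :=
  lam R e 2 - lam R e n.

(* spread_{1,0}(n): maximum over all simple graphs on n vertices
   (max folded from 0; spread_{1,0}(G) >= 0 for n >= 2). *)
Definition spread10n (R : rcfType) (n : nat) : R :=
  \big[Num.max/0]_(g : {ffun 'I_n * 'I_n -> bool}
                    | simple_graph (fun i j => g (i, j)))
     spread10 R (fun i j => g (i, j)).

(* Main.v *)
Require Import Defs.
From HB Require Import structures.
From mathcomp Require Import all_boot all_order all_algebra all_fingroup.
From mathcomp Require Import polyrcf complex spectral.
From mathcomp Require Import all_classical all_reals all_analysis.
From mathcomp Require Import ring lra zify.
Import Order.TTheory GRing.Theory Num.Theory numFieldNormedType.Exports.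
Set Implicit Arguments. Unset Strict Implicit. Unset Printing Implicit Defensive.
Local Open Scope classical_set_scope.
Local Open Scope ring_scope.

(** Write the adjacency matrix as [A = (B + J) / 2] with [J] the all-ones matrix
    and [B] a matrix of signs. Let [x] be a unit vector orthogonal to the
    all-ones vector in the span of the two top eigenvectors of [A], and [y] a
    unit eigenvector for the last eigenvalue. Then
    [2 (lambda_2 - lambda_n) <= <B, x x^T - y y^T>], and Cauchy-Schwarz bounds
    the right-hand side by [n sqrt 2], since [B] has Frobenius norm [n] and
    [x x^T - y y^T] at most [sqrt 2]. In case of equality [B] is proportional
    to [x x^T - y y^T], and [x] and [y] have zero sum: [B] is a sign matrix of
    rank two with zero row sums and zero trace, which forces the four blocks of
    [P_4^*(t)]. Deleting the loops of [P_4^*(t)] costs at most a constant in the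
    spread, whence the limit. *)

(** * Spectrum of real symmetric matrices *)

Lemma char_poly_similar (F : fieldType) (n : nat) (P A D : 'M[F]_n) :
  P \in unitmx -> P *m A = D *m P -> char_poly A = char_poly D.
Proof.
move=> uP PA; rewrite /char_poly.
have PAX : map_mx polyC P *m char_poly_mx A = char_poly_mx D *m map_mx polyC P.
  by rewrite /char_poly_mx mulmxBr mulmxBl scalar_mxC -!map_mxM PA.
have := congr1 (fun M => \det M) PAX; rewrite !det_mulmx mulrC => /mulIf; apply.
by rewrite det_map_mx polyC_eq0 -unitfE -unitmxE.
Qed.

(* Over R[i] the spectral theorem gives a real spectrum; two real matrices that
   are similar over R[i] are similar over R. *)
Lemma symmetric_diagonalizable (R : rcfType) (n : nat) (A : 'M[R]_n) :
  A^T = A ->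
  exists2 P : 'M[R]_n, P \in unitmx & exists d : 'rV[R]_n, P *m A = diag_mx d *m P.
Proof.
move=> symA; pose C := R[i]; pose f : {rmorphism R -> C} := real_complex R.
have fReal (x : C) : x \is Num.real -> f (complex.Re x) = x.
  by case: x => a b; rewrite complex_real => /eqP->.
have f_real m k (M : 'M[R]_(m, k)) : map_mx f M \is a realmx.
  by apply/mxOverP => i j; rewrite mxE /= /real_complex_def complex_real.
have realf m k (M : 'M[C]_(m, k)) :
    M \is a realmx -> M = map_mx f (map_mx (@complex.Re R) M).
  by move=> /mxOverP rM; apply/matrixP => i j; rewrite !mxE fReal.
pose A' := map_mx f A.
have A'herm : A' \is hermsymmx.
  apply: realsym_hermsym; last exact: f_real.
  by apply/is_hermitianmxP; rewrite expr0 scale1r map_mx_id // map_trmx symA.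
have /hermitian_normalmx/orthomx_spectralP A'E := A'herm.
have d_real := hermitian_spectral_diag_real A'herm.
have uS := spectral_unit A'.
have [|||P /= /andP[rP uP]] := @real_similar _ _ A' (diag_mx (spectral_diag A')).
- exists (spectralmx A') => //=.
  by apply/eqP; rewrite conjumx // {2}A'E !mulmxA mulmxV // mul1mx mulmxK.
- exact: f_real.
- apply/mxOverP => i j; rewrite mxE; case: eqP => _; rewrite ?mulr0n ?mulr1n //.
  by have /mxOverP := d_real; apply.
rewrite /similar_to /= conjumx // => /eqP PA.
have {}PA : P *m A' = diag_mx (spectral_diag A') *m P.
  by rewrite -PA mulmxKV.
exists (map_mx (@complex.Re R) P).
  by rewrite -(map_unitmx f) -realf.
exists (map_mx (@complex.Re R) (spectral_diag A')).
apply: (@map_mx_inj _ _ f).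
by rewrite !map_mxM map_diag_mx -!realf.
Qed.

(** Both lists are sorted, and each value occurs in both with its multiplicity as a root; hence any
    splitting of the characteristic polynomial computes [eigs]. *)
Lemma eigsE (R : rcfType) (n : nat) (A : 'M[R]_n) (s : seq R) :
  char_poly A = \prod_(x <- s) ('X - x%:P) -> eigs A = rev (sort <=%R s).
Proof.
move=> pE; rewrite /eigs; congr rev.
have p0 : char_poly A != 0 by exact: monic_neq0 (char_poly_monic A).
apply: le_sorted_eq; last 2 first.
- exact: (sort_sorted le_total).
- rewrite perm_sym perm_sort perm_sym; apply/allP => x _ /=; apply/eqP.
  rewrite count_flatten -map_comp sumnE big_map.
  under eq_bigr do rewrite /= count_nseq /=.
  have := roots_on_rootsR p0 => /(_ x); rewrite /= => rx.
  have uR : uniq (rootsR (char_poly A)).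
    exact: sorted_uniq lt_trans ltxx _ (sorted_roots _ _ _).
  have [xr|xr] := boolP (x \in rootsR (char_poly A)).
    rewrite (bigD1_seq x) //= eqxx mul1n big1 ?addn0 => [|y /negbTE->]; last first.
      by rewrite mul0n.
    by rewrite pE mu_prod_XsubC.
  rewrite big_seq big1 => [|y yr].
    apply/esym/count_memPn; apply: contra xr => xs.
    by rewrite -rx pE root_prod_XsubC.
  by case: eqP => [yx|_]; rewrite ?mul0n // -yx yr in xr.
have : sorted <%R (rootsR (char_poly A)) by exact: sorted_roots.
elim: (rootsR _) => //= x s' IH xs.
rewrite (sorted_pairwise le_trans) pairwise_cat -!(sorted_pairwise le_trans).
rewrite IH ?andbT; last exact: path_sorted xs.
apply/andP; split; last first.
  elim: (mup _ _) => //= k IHk; rewrite path_min_sorted // .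
  by apply/allP => y /nseqP[->].
apply/allrelP => y z /nseqP[-> _] /flattenP[u /mapP[w ws ->] /nseqP[-> _]].
move: xs; rewrite (path_sortedE lt_trans) => /andP[/allP xs _].
exact/ltW/xs.
Qed.

Lemma char_poly_diagonalized (F : fieldType) (n : nat) (A P : 'M[F]_n) (d : 'rV[F]_n) :
  P \in unitmx -> P *m A = diag_mx d *m P ->
  char_poly A = \prod_(x <- [seq d 0 i | i : 'I_n]) ('X - x%:P).
Proof.
move=> uP PA; rewrite (char_poly_similar uP PA).
rewrite char_poly_trig ?diag_mx_is_trig // big_map big_enum /=.
by apply: eq_bigr => i _; rewrite mxE eqxx.
Qed.

Section SymmetricSpectrum.
Variables (R : rcfType) (n : nat) (A : 'M[R]_n).
Hypothesis symA : A^T = A.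

Lemma size_eigs : size (eigs A) = n.
Proof.
have [P uP [d PA]] := symmetric_diagonalizable symA.
rewrite (eigsE (char_poly_diagonalized uP PA)).
by rewrite size_rev size_sort size_map size_enum_ord.
Qed.

Lemma eigs_sorted : sorted >=%R (eigs A).
Proof.
have [P uP [d PA]] := symmetric_diagonalizable symA.
rewrite (eigsE (char_poly_diagonalized uP PA)) rev_sorted.
exact: (sort_sorted le_total).
Qed.

Lemma mem_eigs (a : R) : (a \in eigs A) = eigenvalue A a.
Proof.
have [P uP [d PA]] := symmetric_diagonalizable symA.
rewrite eigenvalue_root_char (char_poly_diagonalized uP PA) root_prod_XsubC.
by rewrite (eigsE (char_poly_diagonalized uP PA)) mem_rev mem_sort.
Qed.

Lemma eigs_antitone (i j : nat) :
  (i <= j)%N -> (j < n)%N -> (eigs A)`_j <= (eigs A)`_i.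
Proof.
move=> ij jn; have := sorted_leq_nth (rev_trans le_trans) lexx 0 eigs_sorted.
by apply; rewrite ?inE ?size_eigs // (leq_ltn_trans ij).
Qed.

Lemma last_eig_le (a : R) : eigenvalue A a -> (eigs A)`_n.-1 <= a.
Proof.
rewrite -mem_eigs => ae; rewrite -(nth_index 0 ae).
have := ae; rewrite -index_mem size_eigs => lt_n.
have n0 : (0 < n)%N by apply: leq_ltn_trans lt_n.
by apply: eigs_antitone; rewrite ?prednK // -ltnS prednK.
Qed.

(** Position 0 holds a value at least [a], so the strictly smaller [b] sits at position 1 or
    later. *)
Lemma second_eig_ge (a b : R) :
  b < a -> eigenvalue A a -> eigenvalue A b -> b <= (eigs A)`_1.
Proof.
rewrite -!mem_eigs => ba ae be.
have := ae; have := be; rewrite -!index_mem size_eigs => ltb lta.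
have [b0|] := posnP (index b (eigs A)).
  have := @eigs_antitone 0 _ (leq0n _) lta.
  by rewrite -b0 !nth_index // leNgt ba.
by move=> b1; rewrite -{1}(nth_index 0 be); apply: eigs_antitone.
Qed.

Lemma last_eigenvector : (0 < n)%N ->
  exists2 y : 'rV[R]_n, y != 0 & y *m A = (eigs A)`_n.-1 *: y.
Proof.
move=> n0; have : (eigs A)`_n.-1 \in eigs A by rewrite mem_nth // size_eigs prednK.
by rewrite mem_eigs => /eigenvalueP[v]; exists v.
Qed.

(** The rows of a diagonalizing matrix are independent eigenvectors, and a permutation matches them
    with the sorted list. This also covers a repeated top eigenvalue. *)
Lemma first_two_eigenvectors : (1 < n)%N ->
  exists u v : 'rV[R]_n,
    [/\ u *m A = (eigs A)`_0 *: u, v *m A = (eigs A)`_1 *: v &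
        forall a b : R, a *: u + b *: v = 0 -> a = 0 /\ b = 0].
Proof.
move=> n1; have [P uP [d PA]] := symmetric_diagonalizable symA.
have rowPA i : row i P *m A = d 0 i *: row i P.
  by rewrite -row_mul PA row_mul row_diag_mx -scalemxAl -rowE.
have szE : size (eigs A) == n by rewrite size_eigs.
have : perm_eq (Tuple szE) [tuple d 0 i | i < n].
  rewrite /= (eigsE (char_poly_diagonalized uP PA)) perm_rev perm_sort.
  exact: perm_refl.
move=> /tuple_permP[s sE].
have eE (i : 'I_n) : (eigs A)`_i = d 0 (s i).
  have /= -> := congr1 (fun t : seq R => t`_i) sE.
  by rewrite (nth_map i) ?size_enum_ord // nth_ord_enum tnth_mktuple.
have n0 : (0 < n)%N by lia.
pose i0 := Ordinal n0; pose i1 := Ordinal n1.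
exists (row (s i0) P), (row (s i1) P); split.
- by rewrite rowPA -eE.
- by rewrite rowPA -eE.
move=> a b; rewrite !rowE !scalemxAl -mulmxDl => /(congr1 (mulmx^~ (invmx P))).
rewrite mulmxK // mul0mx => /rowP ab.
have s01 : s i0 != s i1 by rewrite (inj_eq perm_inj).
have := ab (s i0); have := ab (s i1); rewrite !mxE !eqxx (negbTE s01).
by rewrite eq_sym (negbTE s01) /= !mulr1 !mulr0 addr0 add0r => -> ->.
Qed.

End SymmetricSpectrum.

(** * The spread inequality *)

Definition dotr (R : pzRingType) (n : nat) (u v : 'rV[R]_n) : R :=
  \sum_i u 0 i * v 0 i.

Section DotProduct.
Variables (R : rcfType) (n : nat).
Implicit Types (u v w : 'rV[R]_n) (A : 'M[R]_n).

Lemma dotrC u v : dotr u v = dotr v u.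
Proof. by apply: eq_bigr => i _; rewrite mulrC. Qed.

Lemma dotrDl u v w : dotr (u + v) w = dotr u w + dotr v w.
Proof. by rewrite -big_split; apply: eq_bigr => i _; rewrite mxE mulrDl. Qed.

Lemma dotrZl a u v : dotr (a *: u) v = a * dotr u v.
Proof. by rewrite mulr_sumr; apply: eq_bigr => i _; rewrite mxE mulrA. Qed.

Lemma dotrDr u v w : dotr w (u + v) = dotr w u + dotr w v.
Proof. by rewrite !(dotrC w) dotrDl. Qed.

Lemma dotrZr a u v : dotr u (a *: v) = a * dotr u v.
Proof. by rewrite !(dotrC u) dotrZl. Qed.

Lemma dotr_mulmx u v A :
  dotr (u *m A) v = \sum_i \sum_j A i j * (u 0 i * v 0 j).
Proof.
rewrite exchange_big; apply: eq_bigr => j _; rewrite mxE mulr_suml.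
by apply: eq_bigr => i _; ring.
Qed.

Lemma dotr_mulmxC u v A : A^T = A -> dotr (u *m A) v = dotr (v *m A) u.
Proof.
move=> symA; rewrite !dotr_mulmx exchange_big; apply: eq_bigr => j _.
by apply: eq_bigr => i _; rewrite -{1}symA mxE (mulrC (u _ _)).
Qed.

Lemma dotrr_ge0 u : 0 <= dotr u u.
Proof. by apply: sumr_ge0 => i _; rewrite -expr2 sqr_ge0. Qed.

Lemma dotrr_gt0 u : u != 0 -> 0 < dotr u u.
Proof.
move=> u0; rewrite lt_neqAle dotrr_ge0 andbT eq_sym; apply: contra u0 => /eqP u2.
apply/eqP/rowP => i; rewrite mxE; apply/eqP; rewrite -sqrf_eq0 expr2; apply/eqP.
by apply: (psumr_eq0P _ u2) => // j _; rewrite -expr2 sqr_ge0.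
Qed.

(** Normalising scales both sides of a Rayleigh quotient bound by the same positive factor. *)
Lemma exists_unit_multiple u : u != 0 ->
  exists2 a : R, dotr (a *: u) (a *: u) = 1 &
    forall A c, c * dotr u u <= dotr (u *m A) u ->
      c <= dotr ((a *: u) *m A) (a *: u).
Proof.
move=> /dotrr_gt0 u0; exists (Num.sqrt (dotr u u))^-1 => [|A c cA].
  by rewrite dotrZl dotrZr mulrA -invfM -expr2 sqr_sqrtr ?mulVf ?gt_eqF ?ltW.
rewrite -scalemxAl dotrZl dotrZr mulrA -invfM -expr2.
by rewrite sqr_sqrtr ?dotrr_ge0 // ler_pdivlMl // mulrC.
Qed.

(* On the span of eigenvectors [u], [v] for the two largest eigenvalues the
   quadratic form of [A] dominates the second one, and that span meets the
   orthogonal complement of [w]. *)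
Lemma second_eig_le_qform A w : A^T = A -> (1 < n)%N ->
  exists x : 'rV[R]_n,
    [/\ dotr x x = 1, dotr x w = 0 & (eigs A)`_1 <= dotr (x *m A) x].
Proof.
move=> symA n1; have [u [v [uA vA free_uv]]] := first_two_eigenvectors symA n1.
(* One linear equation in two unknowns has a nontrivial solution; it makes [x] orthogonal to [w]. *)
have [a [b [ab0 abw]]] : exists a b : R,
    (a != 0 \/ b != 0) /\ a * dotr u w + b * dotr v w = 0.
  have [uw0|uw0] := eqVneq (dotr u w) 0.
    by exists 1, 0; split; [left; exact: oner_neq0 | rewrite uw0; ring].
  by exists (dotr v w), (- dotr u w); split; [right; rewrite oppr_eq0 | ring].
pose x := a *: u + b *: v.
have x0 : x != 0.
  by apply/eqP => /free_uv[a0 b0]; rewrite a0 b0 eqxx in ab0; case: ab0.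
have l01 : (eigs A)`_1 <= (eigs A)`_0 by exact: eigs_antitone.
(* If the two eigenvalues coincide, [u] and [v] need not be orthogonal; multiplied by the gap, their
   product vanishes in every case, and the cross term below carries that factor. *)
have uv : ((eigs A)`_0 - (eigs A)`_1) * dotr u v = 0.
  have := dotr_mulmxC u v symA; rewrite uA vA !dotrZl (dotrC v u) => uv.
  by rewrite mulrBl uv subrr.
have [c cx1 cq] := exists_unit_multiple x0; exists (c *: x); split => //.
  by rewrite dotrZl dotrDl !dotrZl abw mulr0.
apply: cq; rewrite -subr_ge0.
have -> : dotr (x *m A) x - (eigs A)`_1 * dotr x x =
   ((eigs A)`_0 - (eigs A)`_1) * (a ^+ 2 * dotr u u)
   + a * b * (((eigs A)`_0 - (eigs A)`_1) * dotr u v).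
  rewrite /x mulmxDl -!scalemxAl uA vA !(dotrDl, dotrDr, dotrZl, dotrZr).
  by rewrite (dotrC v u); ring.
by rewrite uv mulr0 addr0 mulr_ge0 ?subr_ge0 // mulr_ge0 ?sqr_ge0 ?dotrr_ge0.
Qed.

Lemma last_eig_qform A : A^T = A -> (0 < n)%N ->
  exists2 y : 'rV[R]_n, dotr y y = 1 & dotr (y *m A) y = (eigs A)`_n.-1.
Proof.
move=> symA n0; have [v v0 vA] := last_eigenvector symA n0.
have [c cv1 _] := exists_unit_multiple v0; exists (c *: v) => //.
by rewrite -scalemxAl vA scalerA mulrC -scalerA dotrZl cv1 mulr1.
Qed.

End DotProduct.

Lemma adjmx_sym (R : nzRingType) (n : nat) (e : rel 'I_n) :
  symmetric e -> (adjmx R e)^T = adjmx R e.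
Proof. by move=> syme; apply/matrixP => i j; rewrite !mxE syme. Qed.

Lemma sum_pairM (R : comPzRingType) (I : finType) (f g : I -> R) :
  \sum_(p : I * I) f p.1 * g p.2 = (\sum_i f i) * (\sum_i g i).
Proof. by rewrite big_distrlr pair_bigA. Qed.

(* The expansion of the squared Frobenius norm of [(2 A - J) - k (x x^T - y y^T)]. *)
Lemma frobenius_expansion (R : rcfType) (n : nat) (e : rel 'I_n)
    (x y : 'rV[R]_n) (k : R) :
  dotr x x = 1 -> dotr y y = 1 ->
  \sum_(p : 'I_n * 'I_n)
     (2 * (e p.1 p.2)%:R - 1 - k * (x 0 p.1 * x 0 p.2 - y 0 p.1 * y 0 p.2)) ^+ 2
  = n%:R ^+ 2 + k ^+ 2 * (2 - 2 * dotr x y ^+ 2)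
    - 2 * k * (2 * (dotr (x *m adjmx R e) x - dotr (y *m adjmx R e) y)
               - (\sum_i x 0 i) ^+ 2 + (\sum_i y 0 i) ^+ 2).
Proof.
move=> x1 y1; pose a p : R := (e p.1 p.2)%:R.
transitivity (\sum_(p : 'I_n * 'I_n) (1 - 4 * k * (a p * (x 0 p.1 * x 0 p.2))
  + 4 * k * (a p * (y 0 p.1 * y 0 p.2))
  + 2 * k * (x 0 p.1 * x 0 p.2) - 2 * k * (y 0 p.1 * y 0 p.2)
  + k ^+ 2 * ((x 0 p.1 * x 0 p.1) * (x 0 p.2 * x 0 p.2))
  + k ^+ 2 * ((y 0 p.1 * y 0 p.1) * (y 0 p.2 * y 0 p.2))
  - 2 * k ^+ 2 * ((x 0 p.1 * y 0 p.1) * (x 0 p.2 * y 0 p.2)))).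
  (* The entries are 0 or 1, so the square of [2 a - 1] is 1. *)
  by apply: eq_bigr => p _; rewrite /a; case: (e _ _) => /=; ring.
rewrite !big_split /= !sumrN -!mulr_sumr !sum_pairM -!expr2.
rewrite sumr_const card_prod card_ord natrM -expr2.
have qE (z : 'rV[R]_n) :
    \sum_p a p * (z 0 p.1 * z 0 p.2) = dotr (z *m adjmx R e) z.
  rewrite dotr_mulmx pair_bigA; apply: eq_bigr => p _.
  by rewrite mxE.
have dE (u v : 'rV[R]_n) :
    \sum_p u 0 p.1 * v 0 p.1 * (u 0 p.2 * v 0 p.2) = dotr u v ^+ 2.
  exact: (sum_pairM (fun i => u 0 i * v 0 i) (fun i => u 0 i * v 0 i)).
by rewrite !qE !dE x1 y1; ring.
Qed.

Definition signmx (R : pzRingType) (n : nat) (e : rel 'I_n) (i j : 'I_n) : R :=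
  2 * (e i j)%:R - 1.

Lemma spread_sqrt2 (R : rcfType) (n : nat) (e : rel 'I_n) :
  (1 < n)%N -> symmetric e ->
  lam R e 2 - lam R e n <= n%:R / Num.sqrt 2 /\
  (lam R e 2 - lam R e n = n%:R / Num.sqrt 2 ->
   exists k : R, exists x y : 'I_n -> R,
     [/\ forall i j, signmx R e i j = k * (x i * x j - y i * y j),
         forall i, \sum_j signmx R e i j = 0 &
         \sum_i signmx R e i i = 0]).
Proof.
move=> n1 syme; pose A := adjmx R e.
have symA : A^T = A by exact: adjmx_sym.
have [x [x1 xJ xA]] := second_eig_le_qform (const_mx 1) symA n1.
have [y y1 yA] := last_eig_qform symA (ltnW n1).
have sumx : \sum_i x 0 i = 0.
  by rewrite -[RHS]xJ; apply: eq_bigr => i _; rewrite mxE mulr1.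
rewrite /lam /=; set l2 := _`_1 in xA *; set ln := _`_n.-1 in yA *.
pose s : R := Num.sqrt 2.
have s2 : s * s = 2 by rewrite -expr2 sqr_sqrtr.
have s0 : 0 < s by rewrite sqrtr_gt0.
(* The scale forced by equality: for orthonormal [x], [y] the matrix [k (x x^T - y y^T)] has
   Frobenius norm [k sqrt 2], to be matched with [n]. *)
set k := n%:R / Num.sqrt 2.
have k2 : n%:R ^+ 2 = 2 * k ^+ 2.
  by rewrite /k -/s -s2; field; rewrite gt_eqF.
have k0 : 0 < k by rewrite divr_gt0 // ltr0n ltnW.
have := frobenius_expansion e k x1 y1; rewrite -/A yA sumx expr0n subr0 k2.
set q := dotr _ x in xA *; set F := \sum_(p : _) _; set Y := \sum_i y 0 i.
set r := dotr x y => FE.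
have F0 : 0 <= F by apply: sumr_ge0 => p _; exact: sqr_ge0.
(* The deficit [k - (l2 - ln)], scaled by [4 k], is a sum of four nonnegative terms, which all
   vanish when the bound is attained. *)
have key : F + 2 * k ^+ 2 * r ^+ 2 + 2 * k * Y ^+ 2 + 4 * k * (q - l2)
           = 4 * k * (k - (l2 - ln)) by rewrite FE; ring.
have H1 : 0 <= 2 * k ^+ 2 * r ^+ 2
  by apply: mulr_ge0 (sqr_ge0 _); apply: mulr_ge0 (sqr_ge0 _).
have H2 : 0 <= 2 * k * Y ^+ 2
  by apply: mulr_ge0 (sqr_ge0 _); rewrite mulr_ge0 // ltW.
have H3 : 0 <= 4 * k * (q - l2)
  by apply: mulr_ge0; rewrite ?subr_ge0 // mulr_ge0 // ltW.
split.
  have k40 : 0 < 4 * k by exact: mulr_gt0.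
  by rewrite -subr_ge0 -(pmulr_rge0 _ k40) -key !addr_ge0.
move=> lE; move: key; rewrite lE subrr mulr0 => key.
have F00 : F = 0 by lra.
have Y00 : Y = 0.
  apply/eqP; rewrite -sqrf_eq0; apply/eqP; apply: (@mulfI _ (2 * k)).
    by rewrite mulf_neq0 // gt_eqF.
  by rewrite mulr0; lra.
have BE i j : signmx R e i j = k * (x 0 i * x 0 j - y 0 i * y 0 j).
  apply/eqP; rewrite -subr_eq0 -sqrf_eq0; apply/eqP.
  have Fge p : true -> 0 <= (signmx R e p.1 p.2 -
      k * (x 0 p.1 * x 0 p.2 - y 0 p.1 * y 0 p.2)) ^+ 2 by rewrite sqr_ge0.
  by have /(_ (i, j) isT) := psumr_eq0P Fge F00.
exists k, (x 0), (y 0); split => // [i|].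
  under eq_bigr do rewrite BE.
  by rewrite -mulr_sumr sumrB -!mulr_sumr sumx -/Y Y00; ring.
under eq_bigr do rewrite BE.
by rewrite -mulr_sumr sumrB -/(dotr x x) -/(dotr y y) x1 y1 subrr mulr0.
Qed.

(** * The extremal graphs *)

Lemma big_blocks (T : Type) (idx : T) (op : Monoid.law idx) (F : nat -> T) (m t : nat) :
  \big[op/idx]_(i < m * t) F i =
  \big[op/idx]_(a < m) \big[op/idx]_(b < t) F (a * t + b)%N.
Proof.
elim: m => [|m IH]; first by rewrite mul0n !big_ord0.
by rewrite mulSnr big_split_ord /= IH big_ord_recr.
Qed.

Lemma card_block (m t c : nat) :
  (0 < t)%N -> #|[pred i : 'I_(m * t) | (i %/ t == c)%N]| = if (c < m)%N then t else 0%N.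
Proof.
move=> t0; rewrite -sum1_card big_mkcond /=.
rewrite (big_blocks _ (fun i => if (i %/ t == c)%N then 1%N else 0%N)) /=.
under eq_bigr => a _.
  under eq_bigr => b _ do rewrite divnMDl // divn_small // addn0.
  rewrite sum_nat_const card_ord; over.
case: ltnP => cm.
  rewrite (bigD1 (Ordinal cm)) //= eqxx muln1 big1 ?addn0 // => a ac.
  by case: eqP => [/= aE|_]; rewrite ?muln0 //; case/eqP: ac; apply: val_inj.
apply: big1 => a _; case: eqP => [/= aE|_]; rewrite ?muln0 //.
by have := ltn_ord a; rewrite aE ltnNge cm.
Qed.

Section ExtremalStructure.
Variables (R : realFieldType) (n : nat) (e : rel 'I_n) (k : R) (x y : 'I_n -> R).
Hypotheses (n_gt0 : (0 < n)%N) (syme : symmetric e).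
Local Notation B := (signmx R e).
Hypotheses (BE : forall i j, B i j = k * (x i * x j - y i * y j))
  (B_row : forall i, \sum_j B i j = 0) (B_tr : \sum_i B i i = 0).

(** If all diagonal signs agreed, the trace would be [n] or [-n]. *)
Lemma exists_diag_entry (b : bool) : exists i, e i i = b.
Proof.
have [i /eqP ei|noi] := pickP [pred i | e i i == b]; first by exists i.
have eE i : e i i = ~~ b by have /= := noi i; case: (e i i) (b) => [] [].
move: B_tr; under eq_bigr do rewrite /signmx eE.
rewrite sumr_const card_ord => /eqP; rewrite mulrn_eq0 eqn0Ngt n_gt0 /=.
by case: (b) => /eqP /=; lra.
Qed.

(** Take a looped vertex [i0] and an unlooped one [j0]. The minor of [B] on them is [-1 - 1 = -2],
    so rank two lets the columns [i0] and [j0] determine all of [B]. The two signs of a vertex in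
    these columns give its block [f i], numbered along the path with [i0] in block 0 and [j0] in
    block 1 or 2. *)
Lemma extremal_is_p4star_blowup :
  exists t : nat, (0 < t)%N /\ n = (4 * t)%N /\
    exists s : 'S_n, forall i j : 'I_n, e i j = p4star_blowup t (s i) (s j).
Proof.
have [i0 ei0] := exists_diag_entry true; have [j0 ej0] := exists_diag_entry false.
pose p i := e i i0; pose q i := e i j0 == e i0 j0.
pose f i : nat := (2 * ~~ p i + ~~ q i)%N.
(* the 3 x 3 minor on rows i, i0, j0 and columns j, i0, j0 vanishes *)
have minor i j : B i j * (B i0 i0 * B j0 j0 - B i0 j0 * B j0 i0)
    - B i i0 * (B i0 j * B j0 j0 - B i0 j0 * B j0 j)
    + B i j0 * (B i0 j * B j0 i0 - B i0 i0 * B j0 j) = 0.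
  by rewrite !BE; ring.
have ef i j : e i j = p4star (f i) (f j).
  have := minor i j; rewrite /f /p /q /signmx ei0 ej0 (syme j0 i0).
  rewrite (syme i0 j) (syme j0 j).
  by case: (e i j); case: (e i i0); case: (e i j0); case: (e j i0);
     case: (e j j0); case: (e i0 j0) => //=; lra.
have colB j : \sum_i B i j = 0.
  by rewrite -[RHS](B_row j); apply: eq_bigr => i _; rewrite /signmx syme.
(* Fourier inversion over two signs: four times the indicator of block [c] is 1 plus signed copies
   of both column signs and of their product, the loop sign [B i i]. The last three sum to zero by
   the column sums and the trace. *)
have card_f c : (c < 4)%N -> (4 * #|[pred i | f i == c]|)%N = n.
  move=> c4; apply/eqP; rewrite -(eqr_nat R) natrM -sum1_card natr_sum big_mkcond.
  rewrite mulr_sumr /=; apply/eqP.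
  pose sg b : R := if b then -1 else 1.
  transitivity (\sum_i (1 + sg (2 <= c)%N * B i i0 +
     sg (odd c) * B i0 j0 * B i j0 + sg (2 <= c)%N * sg (odd c) * B i i)).
    apply: eq_bigr => i _; rewrite inE /signmx (ef i i) /f /p /q /sg.
    case: c c4 => [|[|[|[|//]]]] _ /=;
    by case: (e i i0); case: (e i j0); case: (e i0 j0) => /=; ring.
  rewrite !big_split /= -!mulr_sumr !colB B_tr !mulr0 !addr0.
  by rewrite sumr_const card_ord.
pose t := #|[pred i | f i == 0%N]|.
have nE : n = (4 * t)%N by rewrite (card_f 0%N).
have t0 : (0 < t)%N by move: n_gt0; rewrite nE; case: (t).
exists t; split=> //; split=> //.
(* [f] and the standard block number take each value equally often, so a permutation of the vertices
   carries one to the other. *)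
have : perm_eq [tuple f i | i < n] [tuple (i %/ t)%N | i < n].
  have cntE (g : 'I_n -> nat) c :
      count_mem c [tuple g i | i < n] = #|[pred i | g i == c]|.
    have -> : [tuple g i | i < n] = [seq g i | i <- enum 'I_n] :> seq nat by [].
    by rewrite count_map -sum1_count -sum1_card big_enum_cond.
  apply/allP => c _; rewrite /= !cntE; have := @card_block 4 t c t0.
  rewrite -nE => ->.
  case: ltnP => c4; last first.
    apply/eqP/eq_card0 => i; rewrite inE /=; apply/negbTE.
    by rewrite neq_ltn (leq_trans _ c4) // /f; case: (p i); case: (q i).
  rewrite -(eqn_pmul2l (isT : 0 < 4)%N) -nE -[X in _ == X](card_f c c4).
  by apply/eqP; congr (_ * _)%N; apply: eq_card => i; rewrite !inE.
move=> /tuple_permP[s sE]; exists s => i j.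
have fE l : f l = (s l %/ t)%N.
  by have := congr1 (fun u : n.-tuple nat => tnth u l) (val_inj sE); rewrite !tnth_mktuple.
by rewrite ef !fE.
Qed.

End ExtremalStructure.

Lemma eigenvalue_adjmx_perm (R : fieldType) (n : nat) (e e' : rel 'I_n) (s : 'S_n) (a : R) :
  (forall i j, e i j = e' (s i) (s j)) ->
  eigenvalue (adjmx R e') a -> eigenvalue (adjmx R e) a.
Proof.
move=> ee' /eigenvalueP[v /rowP vA v0]; apply/eigenvalueP.
exists (\row_i v 0 (s i)); last first.
  apply: contra v0 => /eqP/rowP v0; apply/eqP/rowP => i.
  by have := v0 (s^-1%g i); rewrite !mxE permKV.
apply/rowP => j; have := vA (s j); rewrite !mxE => <-.
rewrite [RHS](reindex_inj (@perm_inj _ s)) /=.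
by apply: eq_bigr => i _; rewrite !mxE ee'.
Qed.

Lemma p4star_sym : symmetric p4star.
Proof.
by move=> a b; rewrite /p4star (andbC (a == 0)%N) (andbC (a == 3)%N) (orbC (a.+1 == b)).
Qed.

(* The [t]-blowup of the closed path on the first [4 t] of [n] vertices, the
   others being isolated; the loops are removed when [d] holds. *)
Definition p4graph (d : bool) (t n : nat) : rel 'I_n := fun i j =>
  [&& (i < 4 * t)%N, (j < 4 * t)%N, p4star_blowup t i j & ~~ (d && (i == j))].

Lemma p4graph_sym (d : bool) (t n : nat) : symmetric (@p4graph d t n).
Proof.
move=> i j; rewrite /p4graph /p4star_blowup p4star_sym eq_sym.
by case: (i < _)%N; case: (j < _)%N.
Qed.

(* The eigenvectors are constant on blocks, equal to [t, h, s h, s t]; the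
   equation for [a] is the characteristic equation of the quotient matrix
   [[t - d, t], [t, s t]]. *)
Lemma p4graph_eigenvalue (R : numFieldType) (d : bool) (t n : nat) (s a : R) :
  (0 < t)%N -> (4 * t <= n)%N -> s * s = 1 ->
  (a - s * t%:R) * (a - t%:R + d%:R) = t%:R ^+ 2 ->
  eigenvalue (adjmx R (@p4graph d t n)) a.
Proof.
move=> t0 tn s2 aE; apply/eigenvalueP.
pose h := a - t%:R + d%:R; pose g := [:: t%:R; h; s * h; s * t%:R].
exists (\row_i if (i < 4 * t)%N then g`_(i %/ t) else 0); last first.
  have n0 : (0 < n)%N by apply: leq_trans tn; rewrite muln_gt0.
  apply/eqP => /rowP/(_ (Ordinal n0)); rewrite !mxE /= muln_gt0 t0 div0n /=.
  by move/eqP; rewrite pnatr_eq0 -leqn0 leqNgt t0.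
apply/rowP => j; rewrite !mxE.
have [j4|j4] := ltnP; last first.
  rewrite mulr0; apply: big1 => i _.
  by rewrite !mxE /p4graph (ltnNge j) j4 /= andbF mulr0.
pose c := (j %/ t)%N.
(* The full blowup, which sums block by block, minus the loop at [j] if it was deleted. *)
transitivity (\sum_(i < n) ((if (i < 4 * t)%N then g`_(i %/ t) * (p4star (i %/ t) c)%:R else 0)
     - (if i == j then d%:R * g`_c * (p4star c c)%:R else 0))).
  apply: eq_bigr => i _; rewrite !mxE /p4graph j4 /p4star_blowup -/c.
  have [->|ij] := eqVneq i j.
    by rewrite j4 -/c /=; case: (d); case: (p4star c c) => /=; ring.
  by rewrite andbF andbT subr0; case: ifP => //= _; rewrite mul0r.
rewrite sumrB -[X in _ - X]big_mkcond big_pred1_eq -big_mkcond.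
rewrite -(big_ord_widen n (fun i => g`_(i %/ t) * (p4star (i %/ t) c)%:R) tn).
rewrite (big_blocks _ (fun i => g`_(i %/ t) * (p4star (i %/ t) c)%:R)) /=.
under eq_bigr => b _.
  under eq_bigr => b' _ do rewrite divnMDl // divn_small // addn0.
  rewrite sumr_const card_ord -[_ *+ t]mulr_natr; over.
have c4 : (c < 4)%N by rewrite ltn_divLR.
have tt : t%:R * t%:R = (a - s * t%:R) * h :> R by rewrite -expr2 aE.
rewrite !big_ord_recr big_ord0 /= -/c.
(* The end blocks hold by the choice of [h], the middle ones by the characteristic equation; [s] is
   the parity of the eigenvector under reversal of the path. *)
case: c c4 => [|[|[|[|//]]]] _ /=; rewrite /p4star /=.
- by rewrite /h; ring.
- apply/eqP; rewrite -subr_eq0; apply/eqP.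
  by transitivity (t%:R * t%:R - (a - s * t%:R) * h); [ring | rewrite tt subrr].
- apply/eqP; rewrite -subr_eq0; apply/eqP.
  transitivity (s * (t%:R * t%:R - (a - s * t%:R) * h) + (1 - s * s) * h * t%:R).
    by ring.
  by rewrite tt s2; ring.
- by rewrite /h; ring.
Qed.

(** * Lower bounds and the limit *)

(** Three known eigenvalues suffice, without the rest of the spectrum: the larger [a] ensures that
    [b] is at most the second one. *)
Lemma spread_ge (R : rcfType) (n : nat) (e : rel 'I_n) (a b c : R) :
  symmetric e -> b < a -> eigenvalue (adjmx R e) a ->
  eigenvalue (adjmx R e) b -> eigenvalue (adjmx R e) c ->
  b - c <= lam R e 2 - lam R e n.
Proof.
move=> /(adjmx_sym R) symA ba ea eb ec.
by apply: lerB; [exact: second_eig_ge ba ea eb | exact: last_eig_le].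
Qed.

Lemma sqrt2_bounds (R : rcfType) :
  [/\ Num.sqrt 2 ^+ 2 = 2 :> R, 1 < Num.sqrt 2 :> R & Num.sqrt 2 < 2 :> R].
Proof.
have s2 : Num.sqrt 2 ^+ 2 = 2 :> R by rewrite sqr_sqrtr.
have s0 : 0 < Num.sqrt 2 :> R by rewrite sqrtr_gt0.
by split=> //; move: (Num.sqrt 2) s0 s2 => s s0 s2; nra.
Qed.

Lemma p4star_blowup_spread (R : rcfType) (t n : nat) (e : rel 'I_n) (s : 'S_n) :
  (0 < t)%N -> n = (4 * t)%N -> symmetric e ->
  (forall i j, e i j = p4star_blowup t (s i) (s j)) ->
  n%:R / Num.sqrt 2 <= lam R e 2 - lam R e n.
Proof.
move=> t0 nE syme eE; have [s2 s1 slt2] := sqrt2_bounds R.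
have tR : (0 : R) < t%:R by rewrite ltr0n.
pose r : R := Num.sqrt 2 * t%:R.
have r2 : r ^+ 2 = 2 * t%:R ^+ 2 by rewrite exprMn s2.
have eE' i j : e i j = p4graph false t (s i) (s j).
  by rewrite /p4graph -nE !ltn_ord andbT eE.
have ev (u a : R) : u * u = 1 -> (a - u * t%:R) * (a - t%:R) = t%:R ^+ 2 ->
    eigenvalue (adjmx R e) a.
  move=> u2 aE; apply: (eigenvalue_adjmx_perm eE').
  by apply: (p4graph_eigenvalue t0 _ u2); rewrite ?nE // addr0.
have -> : n%:R / Num.sqrt 2 = r - - r.
  have snz : Num.sqrt 2 != 0 :> R by rewrite gt_eqF // (lt_trans ltr01).
  apply: (canLR (mulfK snz)); transitivity (2 * Num.sqrt 2 ^+ 2 * t%:R : R).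
    by rewrite s2 nE natrM; ring.
  by rewrite /r; ring.
(* Parity 1 gives the eigenvalue [2 t], which exceeds [r]; parity -1 gives both [r] and [- r]. *)
apply: (@spread_ge _ _ _ (2 * t%:R)) => //.
- by rewrite ltr_pM2r.
- by apply: (ev 1); ring.
- by apply: (ev (-1)); [ring | transitivity (r ^+ 2 - t%:R ^+ 2); [ring | rewrite r2; ring]].
- by apply: (ev (-1)); [ring | transitivity (r ^+ 2 - t%:R ^+ 2); [ring | rewrite r2; ring]].
Qed.

(** The two eigenvalues of parity -1 differ by [u], where [u^2 = 8 t^2 - 4 t + 1] is at least [(2
    sqrt 2 t - 1)^2 = 8 t^2 - 4 sqrt 2 t + 1]. An eigenvalue of parity 1 lies above both. *)
Lemma loopless_p4graph_spread (R : rcfType) (t n : nat) :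
  (0 < t)%N -> (4 * t <= n)%N ->
  2 * Num.sqrt 2 * t%:R - 1 <= spread10 R (@p4graph true t n).
Proof.
move=> t0 tn; have [s2 s1 slt2] := sqrt2_bounds R.
have t1 : (1 : R) <= t%:R by rewrite ler1n.
have ev (z a : R) : z * z = 1 -> (a - z * t%:R) * (a - t%:R + 1) = t%:R ^+ 2 ->
    eigenvalue (adjmx R (@p4graph true t n)) a.
  by move=> z2 aE; apply: (p4graph_eigenvalue t0 tn z2).
move: (t%:R) (Num.sqrt 2) s2 s1 slt2 t1 ev => T s s2 s1 slt2 T1 ev.
(* [w ^+ 2] and [u ^+ 2] are the discriminants of the quadratics in [ev] for [z = 1] and
   [z = -1]. *)
pose w : R := Num.sqrt (4 * T ^+ 2 + 1).
pose u : R := Num.sqrt (8 * T ^+ 2 - 4 * T + 1).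
have w2 : w ^+ 2 = 4 * T ^+ 2 + 1 by rewrite sqr_sqrtr //; nra.
have u2 : u ^+ 2 = 8 * T ^+ 2 - 4 * T + 1 by rewrite sqr_sqrtr //; nra.
have w0 : 0 <= w by exact: sqrtr_ge0.
have u0 : 0 <= u by exact: sqrtr_ge0.
(* These two bounds give [u < 2 T + w], which orders the top two of the chosen eigenvalues. *)
have wT : 2 * T <= w by nra.
have uT : u <= 3 * T by nra.
have us : 2 * s * T - 1 <= u.
  rewrite leNgt; apply/negP => lt_u.
  have sT : 0 <= (s - 1) * T by apply: mulr_ge0; lra.
  have : 0 < (2 * s * T - 1 - u) * (2 * s * T - 1 + u) by apply: mulr_gt0; lra.
  suff -> : (2 * s * T - 1 - u) * (2 * s * T - 1 + u) = - (4 * ((s - 1) * T)) by lra.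
  by transitivity (4 * s ^+ 2 * T ^+ 2 - 4 * s * T + 1 - u ^+ 2);
    [ring | rewrite s2 u2; ring].
apply: (le_trans us); rewrite [leLHS](_ : u = (u - 1) / 2 - (- u - 1) / 2); last first.
  by field.
apply: (@spread_ge _ _ _ ((2 * T - 1 + w) / 2)).
- exact: p4graph_sym.
- lra.
- apply: (ev 1); first by ring.
  by transitivity ((w ^+ 2 - 1) / 4); [field | rewrite w2; field].
- apply: (ev (-1)); first by ring.
  by transitivity ((u ^+ 2 - (2 * T - 1) ^+ 2) / 4); [field | rewrite u2; field].
- apply: (ev (-1)); first by ring.
  by transitivity ((u ^+ 2 - (2 * T - 1) ^+ 2) / 4); [field | rewrite u2; field].
Qed.

Lemma spread10n_le (R : rcfType) (n : nat) :
  (1 < n)%N -> spread10n R n <= n%:R / Num.sqrt 2.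
Proof.
(* The maximum is folded from 0, so the bound must also be nonnegative. *)
move=> n1; apply/bigmax_leP; split; first by rewrite divr_ge0 ?sqrtr_ge0.
move=> g /andP[_ /forallP symg]; apply: (spread_sqrt2 R n1 _).1 => i j.
by have /forallP/(_ j)/eqP := symg i.
Qed.

(** With [t = n %/ 4] at most three vertices stay isolated, which costs [3 / sqrt 2]; deleting the
    loops costs 1. *)
Lemma spread10n_ge (R : rcfType) (n : nat) : (3 < n)%N ->
  (n%:R - 3) / Num.sqrt 2 - 1 <= spread10n R n.
Proof.
move=> n3; pose t := (n %/ 4)%N.
have t0 : (0 < t)%N by rewrite divn_gt0.
have tn : (4 * t <= n)%N by rewrite mulnC leq_trunc_div.
have nt : (n <= 4 * t + 3)%N by rewrite /t; lia.
have [s2 s1 slt2] := sqrt2_bounds R.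
pose g : {ffun 'I_n * 'I_n -> bool} := [ffun p => p4graph true t p.1 p.2].
have gE : adjmx R (fun i j => g (i, j)) = adjmx R (@p4graph true t n).
  by apply/matrixP => i j; rewrite !mxE ffunE.
have sg : simple_graph (fun i j => g (i, j)).
  apply/andP; split; apply/forallP => i; first by rewrite ffunE /p4graph eqxx !andbF.
  by apply/forallP => j; rewrite !ffunE /= p4graph_sym.
pose F (h : {ffun 'I_n * 'I_n -> bool}) := spread10 R (fun i j => h (i, j)).
pose S (h : {ffun 'I_n * 'I_n -> bool}) := simple_graph (fun i j => h (i, j)).
have := @le_bigmax_cond _ _ _ 0 g S F sg.
apply: le_trans; rewrite /F /spread10 /lam gE; apply: le_trans (loopless_p4graph_spread R t0 tn).
rewrite lerD2r ler_pdivrMr; last by lra.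
rewrite [leRHS](_ : _ = 4 * t%:R); last first.
  by transitivity (2 * Num.sqrt 2 ^+ 2 * t%:R : R); [ring | rewrite s2; ring].
by rewrite lerBlDr -natrM -natrD ler_nat.
Qed.

Theorem theorem1p4 (R : realType) :
  (forall (n : nat) (e : rel 'I_n), (2 <= n)%N -> symmetric e ->
     lam R e 2 - lam R e n <= n%:R / Num.sqrt 2 /\
     (lam R e 2 - lam R e n = n%:R / Num.sqrt 2 <->
        exists t : nat, (0 < t)%N /\ n = (4 * t)%N /\
          exists s : 'S_n, forall i j : 'I_n,
            e i j = p4star_blowup t (s i) (s j)))
  /\
  (fun n : nat => spread10n R n / n%:R) @ \oo --> (Num.sqrt (2 : R))^-1.
Proof.
split=> [n e n2 syme|].
  have [le_sp eq_sp] := spread_sqrt2 R n2 syme; split=> //; split.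
    move=> /eq_sp[k [x [y [BE B_row B_tr]]]].
    exact: extremal_is_p4star_blowup (ltnW n2) syme BE B_row B_tr.
  move=> [t [t0 [nE [s eE]]]]; apply/le_anti; rewrite le_sp /=.
  exact: p4star_blowup_spread t0 nE syme eE.
have [s2 s1 slt2] := sqrt2_bounds R.
pose r : R := (Num.sqrt 2)^-1.
have r0 : 0 < r by rewrite invr_gt0; lra.
have r1 : r < 1 by rewrite invf_lt1; lra.
(* The lower bound divided by [n] is [r - (3 r + 1) / n], and [3 r + 1 < 4 <= 8 n / (n + 1)]; the 8
   absorbs the shift in [harmonic n = 1 / (n + 1)]. *)
apply: (@squeeze_cvgr _ _ _ _ (fun n => r - 8 * harmonic n) (fun=> r)).
- near=> n.
  have n4 : (3 < n)%N by near: n; exists 4%N.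
  have n0 : (0 : R) < n%:R by rewrite ltr0n; lia.
  rewrite ler_pdivlMr // ler_pdivrMr // [r * _]mulrC spread10n_le ?andbT; last by lia.
  apply: le_trans (spread10n_ge R n4); rewrite -/r /harmonic /=.
  have h : (n%:R : R) / n.+1%:R * 8 >= 4.
    by rewrite -mulrAC ler_pdivlMr ?ltr0Sn // -!natrM ler_nat; lia.
  rewrite mulrBl (_ : 8 / _ * _ = n%:R / n.+1%:R * 8); last by rewrite mulrAC -mulrA mulrC.
  by move: (n%:R / n.+1%:R) h => X h; rewrite [_ * r]mulrBl [r * _]mulrC; lra.
- have : r - 8 * harmonic n @[n --> \oo] --> r - 8 * 0.
    by apply: cvgB; [exact: cvg_cst | apply: cvgMr; exact: cvg_harmonic].
  by rewrite mulr0 subr0.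
- exact: cvg_cst.
Unshelve. all: by end_near.
Qed.
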